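(* Let $m$ be a positive integer, let $r\ge0$, let $\alpha>0$, and let $\lambda$ be a nonzero real number. Let $X$ be a Poisson random variable with parameter $\frac{\alpha}{m}$. Then for every integer $n\ge0$, $$D^{(r)}_{m,\lambda}(n,\alpha)=E[(mX+r)_{n,\lambda}]=\sum_{j=0}^n\Big(\sum_{k=j}^nW^{(r)}_{m,\lambda}(n,k)\,m^k\,S_1(k,j)\Big)\phi_j\Big(\frac{\alpha}{m}\Big).$$
   Context: For real $x$ and nonzero real $\lambda$, $(x)_{0,\lambda}=1$, $(x)_{n,\lambda}=x(x-\lambda)\cdots(x-(n-1)\lambda)$ for $n\ge1$; $(x)_0=1$, $(x)_k=x(x-1)\cdots(x-k+1)$. The (signed) Stirling numbers of the first kind $S_1(n,k)$ are defined by $(x)_n=\sum_{k=0}^nS_1(n,k)x^k$; the Stirling numbers of the second kind by $x^n=\sum_{k=0}^nS_2(n,k)(x)_k$; the Bell polynomials by $\phi_n(x)=\sum_{k=0}^nS_2(n,k)x^k$ (equivalently $e^{x(e^t-1)}=\sum_n\phi_n(x)\frac{t^n}{n!}$). The degenerate $r$-Whitney numbers of the second kind $W^{(r)}_{m,\lambda}(n,k)$ are defined by $(mx+r)_{n,\lambda}=\sum_{k=0}^nW^{(r)}_{m,\lambda}(n,k)m^k(x)_k$, and the degenerate $r$-Dowling polynomials by $D^{(r)}_{m,\lambda}(n,x)=\sum_{k=0}^nW^{(r)}_{m,\lambda}(n,k)x^k$. *)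

(* Defs.v *)
From mathcomp Require Import all_boot all_order all_algebra.
From mathcomp Require Import all_classical all_reals all_analysis.

Set Implicit Arguments.
Unset Strict Implicit.
Unset Printing Implicit Defensive.
Import Order.TTheory GRing.Theory Num.Theory.
Import numFieldNormedType.Exports.
Local Open Scope classical_set_scope.
Local Open Scope ring_scope.

Section falling.
Context {R : realType}.
Implicit Types (x lambda : R) (n : nat).

(* (x)_{n,lambda} = x (x - lambda) ... (x - (n-1) lambda) *)
Definition dfalling lambda x n : R := \prod_(i < n) (x - i%:R * lambda).

(* (x)_n = x (x - 1) ... (x - n + 1); the library's _ ^_ _ is restricted to
   natural numbers *)
Definition falling x n : R := \prod_(i < n) (x - i%:R).

End falling.

Section expansion.
Context {R : realType}.
Implicit Types (f : R -> R) (e : nat -> R -> R) (c : nat -> R) (n k : nat).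

(* c is the sequence of coefficients of f in terms of e 0, ..., e n; the
   convention c k = 0 for k > n makes c unique in the cases considered below *)
Definition expansion n f e c : Prop :=
  (forall x, f x = \sum_(k < n.+1) c k * e k x) /\
  (forall k, (n < k)%N -> c k = 0).

(* "the" coefficients; see coefs_expansion and expansion_unique *)
Definition coefs n f e : nat -> R := xget (fun=> 0) [set c | expansion n f e c].

End expansion.

Section numbers.
Context {R : realType}.
Implicit Types (x r lambda : R) (m n k : nat).

Definition stirling1 n k : R :=
  coefs n (fun x => falling x n) (fun k x => x ^+ k) k.

Definition stirling2 n k : R :=
  coefs n (fun x => x ^+ n) (fun k x => falling x k) k.

Definition bell n x : R := \sum_(k < n.+1) stirling2 n k * x ^+ k.

Definition whitney2 m r lambda n k : R :=
  coefs n (fun x => dfalling lambda (m%:R * x + r) n)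
    (fun k x => m%:R ^+ k * falling x k) k.

Definition dowling m r lambda n x : R :=
  \sum_(k < n.+1) whitney2 m r lambda n k * x ^+ k.

End numbers.

Definition poisson_RV d (T : measurableType d) (R : realType)
    (P : probability T R) (X : {RV P >-> nat}) (rate : R) : Prop :=
  forall i : nat, P [set t | X t = i] = (poisson_pmf rate i)%:E.

Section expansion_theory.
Context {R : realType}.
Implicit Types (f : R -> R) (e : nat -> R -> R) (c : nat -> R) (n k : nat).
Implicit Types (p : {poly R}) (b : nat -> {poly R}).

Lemma horner_sum_basis b c n x :
  (\sum_(k < n) c k *: b k).[x] = \sum_(k < n) c k * (b k).[x].
Proof. by rewrite horner_sum; apply: eq_bigr => k _; rewrite hornerZ. Qed.

Lemma poly_fun0 p : (forall x, p.[x] = 0) -> p = 0.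
Proof.
move=> p0; apply/eqP/contraT => /max_poly_roots.
move=> /(_ [seq i%:R | i <- iota 0 (size p)]).
rewrite size_map size_iota ltnn; apply.
- by apply/allP => x _; rewrite rootE p0.
- by rewrite map_inj_uniq ?iota_uniq// => i j /eqP; rewrite eqr_nat => /eqP.
Qed.

Lemma basis_expand b n p : (forall k, size (b k) = k.+1) ->
  (size p <= n)%N -> exists c, p = \sum_(k < n) c k *: b k.
Proof.
move=> bS; elim: n p => [|n IHn] p sp.
  exists (fun=> 0); rewrite big_ord0; apply/eqP.
  by rewrite -size_poly_eq0 -leqn0.
have bn0 : (b n)`_n != 0.
  by have := lead_coef_eq0 (b n); rewrite lead_coefE bS/= -size_poly_eq0 bS => ->.
pose a := p`_n / (b n)`_n.
have /IHn[c pE] : (size (p - a *: b n)%R <= n)%N.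
  apply/leq_sizeP => j; rewrite leq_eqVlt => /predU1P[<-|nj].
    by rewrite coefB coefZ divfK// subrr.
  have pj : p`_j = 0 by rewrite nth_default// (leq_trans sp).
  have bj : (b n)`_j = 0 by rewrite nth_default// bS.
  by rewrite coefB coefZ pj bj mulr0 subrr.
exists (fun k : nat => if k == n then a else c k).
rewrite big_ord_recr/= eqxx -[LHS](subrK (a *: b n)) pE; congr (_ + _).
by apply: eq_bigr => k _; rewrite ltn_eqF.
Qed.

Lemma basis_free b n c : (forall k, size (b k) = k.+1) ->
  \sum_(k < n) c k *: b k = 0 -> forall k, (k < n)%N -> c k = 0.
Proof.
move=> bS; elim: n => // n IHn; rewrite big_ord_recr/= => s0.
have bn0 : (b n)`_n != 0.
  by have := lead_coef_eq0 (b n); rewrite lead_coefE bS/= -size_poly_eq0 bS => ->.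
have cn : c n = 0.
  have /(congr1 (fun p : {poly R} => p`_n)) := s0.
  rewrite coefD coef0 coefZ coef_sum big1 ?add0r => [/eqP|k _]; last first.
    by rewrite coefZ nth_default ?mulr0// bS.
  by rewrite mulf_eq0 (negPf bn0) orbF => /eqP.
move=> k; rewrite ltnS leq_eqVlt => /predU1P[->//|]; apply: IHn.
by move: s0; rewrite cn scale0r addr0.
Qed.

Lemma coefs_expansion n f e p b : (forall x, f x = p.[x]) ->
  (forall k x, e k x = (b k).[x]) -> (size p <= n.+1)%N ->
  (forall k, size (b k) = k.+1) -> expansion n f e (coefs n f e).
Proof.
move=> fE eE sp bS; have [c pE] := basis_expand bS sp.
suff : expansion n f e (fun k => if (k <= n)%N then c k else 0).
  exact: (@xgetI _ (fun=> 0) [set c | expansion n f e c]).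
split=> [x|k].
- rewrite fE pE horner_sum_basis; apply: eq_bigr => k _.
  by rewrite eE -ltnS ltn_ord.
- by rewrite ltnNge => /negPf ->.
Qed.

Lemma expansion_unique n f e b c c' : (forall k x, e k x = (b k).[x]) ->
  (forall k, size (b k) = k.+1) ->
  expansion n f e c -> expansion n f e c' -> c = c'.
Proof.
move=> eE bS [fc c0] [fc' c'0]; apply/funext => k.
have [kn|nk] := ltnP k n.+1; last by rewrite c0// c'0.
apply/eqP; rewrite -subr_eq0; apply/eqP.
apply: (basis_free (n := n.+1) (c := fun k => c k - c' k) bS) kn.
apply: poly_fun0 => x; rewrite (horner_sum_basis b (fun k => c k - c' k)).
under eq_bigr do rewrite mulrBl.
rewrite sumrB; apply/eqP; rewrite subr_eq0; apply/eqP.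
transitivity (f x); [rewrite fc|rewrite fc'];
  by apply: eq_bigr => i _; rewrite eE.
Qed.

End expansion_theory.

Section numbers_theory.
Context {R : realType}.
Implicit Types (x r lambda : R) (m n k : nat).

Definition falling_poly n : {poly R} := \prod_(i < n) ('X - i%:R%:P).

Lemma falling_polyE x n : falling x n = (falling_poly n).[x].
Proof.
by rewrite horner_prod; apply: eq_bigr => i _; rewrite hornerXsubC.
Qed.

Lemma size_falling_poly n : size (falling_poly n) = n.+1.
Proof. by rewrite size_prod_XsubC /index_enum -enumT size_enum_ord. Qed.

Definition dfalling_poly m r lambda n : {poly R} :=
  \prod_(i < n) (m%:R *: 'X + (r - i%:R * lambda)%:P).

Lemma dfalling_polyE m r lambda n x :
  dfalling lambda (m%:R * x + r) n = (dfalling_poly m r lambda n).[x].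
Proof.
rewrite horner_prod; apply: eq_bigr => i _.
by rewrite hornerD hornerZ hornerX hornerC addrA.
Qed.

Lemma size_dfalling_poly m r lambda n :
  (size (dfalling_poly m r lambda n) <= n.+1)%N.
Proof.
rewrite /dfalling_poly; elim: n => [|n IHn]; first by rewrite big_ord0 size_poly1.
rewrite big_ord_recr/=; apply: leq_trans (size_polyMleq _ _) _.
have s2 : (size (m%:R *: 'X + (r - n%:R * lambda)%:P : {poly R})%R <= 2)%N.
  apply: leq_trans (size_polyD _ _) _; rewrite geq_max.
  rewrite (leq_trans (size_scale_leq _ _)) ?size_polyX//.
  by rewrite (leq_trans (size_polyC_leq1 _)).
by rewrite -subn1 leq_subLR (leq_trans (leq_add IHn s2))// addn2.
Qed.

Lemma stirling1_expansion n :
  expansion n (fun x => falling x n) (fun k x => x ^+ k) (stirling1 n).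
Proof.
apply: (@coefs_expansion _ n _ _ (falling_poly n) (fun k => 'X^k)).
- by move=> x; exact: falling_polyE.
- by move=> k x; rewrite hornerXn.
- by rewrite size_falling_poly.
- by move=> k; rewrite size_polyXn.
Qed.

Lemma stirling2_expansion n :
  expansion n (fun x => x ^+ n) (fun k x => falling x k) (stirling2 n).
Proof.
apply: (@coefs_expansion _ n _ _ 'X^n falling_poly).
- by move=> x; rewrite hornerXn.
- by move=> k x; exact: falling_polyE.
- by rewrite size_polyXn.
- exact: size_falling_poly.
Qed.

Lemma whitney2_expansion m r lambda n : (0 < m)%N ->
  expansion n (fun x => dfalling lambda (m%:R * x + r) n)
    (fun k x => m%:R ^+ k * falling x k) (whitney2 m r lambda n).
Proof.
move=> m0.
apply: (@coefs_expansion _ n _ _ (dfalling_poly m r lambda n)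
  (fun k => m%:R ^+ k *: falling_poly k)).
- by move=> x; exact: dfalling_polyE.
- by move=> k x; rewrite hornerZ falling_polyE.
- exact: size_dfalling_poly.
- move=> k; rewrite size_scale ?size_falling_poly//.
  by rewrite expf_neq0// pnatr_eq0 -lt0n.
Qed.

End numbers_theory.

(* Main.v *)
Require Import Defs.
From mathcomp Require Import all_boot all_order all_algebra.
From mathcomp Require Import all_classical all_reals all_analysis.
From mathcomp Require Import ring measurable_realfun.
Set Implicit Arguments.
Unset Strict Implicit.
Unset Printing Implicit Defensive.
Import Order.TTheory GRing.Theory Num.Theory.
Import numFieldNormedType.Exports.
Local Open Scope classical_set_scope.
Local Open Scope ring_scope.

(** The falling factorial moments of a Poisson variable are the powers of its
    parameter: E[(X)_k] = rate^k, by shifting the summation index by k. Hence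
    E[p(X)] is obtained from the expansion of a polynomial p in falling
    factorials by the substitution (x)_k -> rate^k. For (mx + r)_{n,lambda}
    this yields D(n, alpha), and for x^j it yields phi_j(rate). Expanding (x)_k
    in powers of x and taking expectations gives
    rate^k = \sum_j S_1(k, j) phi_j(rate), whence the second equality. *)

Lemma falling_nat (R : realType) (i k : nat) :
  falling (i%:R : R) k = (i ^_ k)%:R.
Proof.
have [ki|ik] := leqP k i.
  rewrite ffact_prod natr_prod; apply: eq_bigr => j _.
  by rewrite natrB// ltnW// (leq_trans (ltn_ord j)).
(* For [i < k] the factor with index [i] is zero. *)
by rewrite ffact_small// /falling (bigD1 (Ordinal ik))//= subrr mul0r.
Qed.

Lemma poisson_pmf_sum1 (R : realType) (rate : R) : 0 < rate ->
  (\sum_(i <oo) (poisson_pmf rate i)%:E = 1)%E.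
Proof.
move=> rate0; rewrite nneseries_esumT; last first.
  by move=> *; rewrite lee_fin poisson_pmf_ge0.
transitivity (poisson_prob rate 0 setT); last exact: probability_setT.
by rewrite /poisson_prob rate0.
Qed.

(** The falling factorial cancels the top [k] factors of [(i + k)!] in the denominator, leaving
    [i!]. *)
Lemma poisson_pmf_ffact (R : realType) (rate : R) (i k : nat) : 0 < rate ->
  ((i + k) ^_ k)%:R * poisson_pmf rate (i + k) = rate ^+ k * poisson_pmf rate i.
Proof.
move=> rate0; rewrite /poisson_pmf rate0.
have := ffact_fact (leq_addl i k); rewrite addnK => <-.
have f0 : ((i + k) ^_ k)%:R != 0 :> R.
  by rewrite pnatr_eq0 -lt0n ffact_gt0 leq_addl.
have i0 : i`!%:R != 0 :> R by rewrite pnatr_eq0 -lt0n fact_gt0.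
by rewrite natrM exprD; field; rewrite f0 i0.
Qed.

Lemma poisson_pmf_ffact_sum (R : realType) (rate : R) (k : nat) : 0 < rate ->
  (\sum_(i <oo) ((i ^_ k)%:R * poisson_pmf rate i)%:E = (rate ^+ k)%:E)%E.
Proof.
move=> rate0.
have ge0 i : (0 <= ((i ^_ k)%:R * poisson_pmf rate i)%:E)%E.
  by rewrite lee_fin mulr_ge0// poisson_pmf_ge0.
(* The terms with [i < k] vanish; shifting the others by [k] leaves [rate ^+ k] times the total
   mass. *)
rewrite (nneseries_split _ k)// add0n big_nat big1 => [|i ik]; last first.
  by rewrite ffact_small ?mul0r.
rewrite add0e -nneseries_addn//.
under eq_eseriesr do rewrite poisson_pmf_ffact// EFinM.
rewrite nneseriesZl ?poisson_pmf_sum1 ?mule1// => i _.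
by rewrite lee_fin poisson_pmf_ge0.
Qed.

Section poisson_moments.
Context d (T : measurableType d) (R : realType) (P : probability T R).

(** Every subset of [nat] is measurable, so nothing is asked of [g]. *)
Lemma measurable_fun_nat_comp (X : {RV P >-> nat}) d'
    (U : measurableType d') (g : nat -> U) :
  measurable_fun [set: T] (fun t => g (X t)).
Proof.
move=> _ B _; rewrite setTI.
exact: (@measurable_funPTI _ _ _ _ X (g @^-1` B)).
Qed.

(** The fibres of [X] partition the space into countably many measurable sets, and the integrand is
    constant on each. *)
Lemma ge0_integral_discrete (X : {RV P >-> nat}) (g : nat -> R) :
  (forall i, 0 <= g i) ->
  (\int[P]_t (g (X t))%:E = \sum_(i <oo) ((g i)%:E * P [set t | X t = i]))%E.
Proof.
move=> g0.
have mX i : measurable [set t | X t = i].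
  exact: (@measurable_funPTI _ _ _ _ X [set i]).
have XT : [set: T] = \bigcup_i [set t | X t = i].
  by apply/seteqP; split=> // t _; exists (X t).
rewrite XT ge0_integral_bigcup//=.
- apply: eq_eseriesr => i _.
  rewrite (eq_integral (cst (g i)%:E)) ?integral_cst// => t.
  by rewrite inE/= => ->.
- rewrite -XT.
  exact: (measurable_fun_nat_comp X (EFin \o g)).
- by move=> t _; rewrite lee_fin.
- by apply/trivIsetP => i j _ _ ij; rewrite -subset0 => t []/= -> /eqP; exact/negP.
Qed.

(** Linearity of expectation, in the form of the substitution of [v k] for [e k]. Integrability is
    part of the conclusion so that the result can serve as input for a further expansion. *)
Lemma expansion_expectation (Y : T -> R) n (f : R -> R) e c v :
  expansion n f e c ->
  (forall k, (fun t => e k (Y t)) \in Lfun P 1) ->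
  (forall k, ('E_P[fun t => e k (Y t)] = (v k)%:E)%E) ->
  (fun t => f (Y t)) \in Lfun P 1 /\
  ('E_P[fun t => f (Y t)] = (\sum_(k < n.+1) c k * v k)%:E)%E.
Proof.
move=> [fE _] eL Ee.
pose g k t := ((c k)%:E * (e k (Y t))%:E)%E.
have gI k : P.-integrable setT (g k).
  by apply: integrableZl => //; exact/Lfun1_integrable.
have fg t : (f (Y t))%:E = (\sum_(k < n.+1) g k t)%E.
  by rewrite fE -sumEFin; apply: eq_bigr => k _; rewrite EFinM.
split.
- apply/Lfun1_integrable.
  rewrite (_ : _ \o _ = fun t => \sum_(k < n.+1) g k t)%E; last exact/funext.
  exact: integrable_sum.
- rewrite unlock; under eq_integral do rewrite fg.
  rewrite integral_sum// -sumEFin; apply: eq_bigr => k _.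
  rewrite integralZl//; last exact/Lfun1_integrable.
  by have := Ee k; rewrite unlock EFinM => ->.
Qed.

Section poisson.
Context (X : {RV P >-> nat}) (rate : R).
Hypotheses (rate_gt0 : 0 < rate) (X_poisson : poisson_RV X rate).

Lemma expectation_falling k :
  ('E_P[fun t => falling (X t)%:R k] = (rate ^+ k)%:E)%E.
Proof.
under eq_fun do rewrite falling_nat.
rewrite unlock (@ge0_integral_discrete X (fun i => (i ^_ k)%:R))//.
by rewrite -poisson_pmf_ffact_sum//; apply: eq_eseriesr => i _; rewrite X_poisson.
Qed.

Lemma Lfun_falling k : (fun t => falling (X t)%:R k : R) \in Lfun P 1.
Proof.
apply/Lfun1_integrable/integrableP; split.
  exact: (measurable_fun_nat_comp X (fun i => (falling i%:R k : R)%:E)).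
have := expectation_falling k; rewrite unlock => E.
(* Falling factorials are nonnegative at natural numbers, so the integral of the absolute value is
   the expectation already computed, which is finite. *)
under eq_integral do rewrite /= falling_nat ger0_norm// -falling_nat.
by rewrite E ltry.
Qed.

Lemma moment_bell j :
  (fun t => (X t)%:R ^+ j : R) \in Lfun P 1 /\
  ('E_P[fun t => ((X t)%:R ^+ j)%R] = (bell j rate)%:E)%E.
Proof.
exact: (expansion_expectation (stirling2_expansion j)
  Lfun_falling expectation_falling).
Qed.

(** Both sides are the expectation of [falling X k]: the left one through its expansion in powers of
    [X], the right one directly. No inversion formula between the two kinds of Stirling numbers is
    used. *)
Lemma sum_stirling1_bell k :
  \sum_(j < k.+1) stirling1 k j * bell j rate = rate ^+ k.
Proof.
apply: EFin_inj; rewrite -expectation_falling.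
have [_ ->//] := expansion_expectation (stirling1_expansion k)
  (fun j => (moment_bell j).1) (fun j => (moment_bell j).2).
Qed.

Lemma expectation_dfalling m r lambda n : (0 < m)%N ->
  ('E_P[fun t => dfalling lambda (m%:R * (X t)%:R + r) n] =
   (\sum_(k < n.+1) whitney2 m r lambda n k * (m%:R ^+ k * rate ^+ k))%:E)%E.
Proof.
move=> m_gt0.
have scaleE k : (fun t => m%:R ^+ k * falling (X t)%:R k) =
    (m%:R ^+ k : R) \o* (fun t => falling (X t)%:R k).
  by apply/funext => t; rewrite /= mulrC.
have [||_ ->//] := @expansion_expectation (fun t => (X t)%:R) n _ _ _
  (fun k => m%:R ^+ k * rate ^+ k) (whitney2_expansion r lambda n m_gt0) => k.
- by rewrite scaleE Lfun_scale// Lfun_falling.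
- by rewrite scaleE expectationZl ?Lfun_falling// expectation_falling EFinM.
Qed.

End poisson.
End poisson_moments.

Theorem theorem6 (R : realType) (m : nat) (m_gt0 : (0 < m)%N)
    (r : R) (r_ge0 : 0 <= r) (alpha : R) (alpha_gt0 : 0 < alpha)
    (lambda : R) (lambda_neq0 : lambda != 0)
    (d : measure_display) (T : measurableType d) (P : probability T R)
    (X : {RV P >-> nat}) (X_poisson : poisson_RV X (alpha / m%:R))
    (n : nat) :
  (dowling m r lambda n alpha)%:E
    = 'E_P[fun t => dfalling lambda (m%:R * (X t)%:R + r) n]%E
  /\
  'E_P[fun t => dfalling lambda (m%:R * (X t)%:R + r) n]%E
    = (\sum_(0 <= j < n.+1)
         (\sum_(j <= k < n.+1)
            whitney2 m r lambda n k * m%:R ^+ k * stirling1 k j)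
         * bell j (alpha / m%:R))%:E.
Proof.
have m_neq0 : m%:R != 0 :> R by rewrite pnatr_eq0 -lt0n.
have rate_gt0 : 0 < alpha / m%:R by rewrite divr_gt0// ltr0n.
rewrite (expectation_dfalling rate_gt0 X_poisson)//; split; congr EFin.
(* The powers of [m] cancel: [m * (alpha / m) = alpha]. *)
- by apply: eq_bigr => k _; rewrite -exprMn [m%:R * _]mulrC divfK.
(* Exchange the sums over the triangle [j <= k <= n], so that the inner sum over [j] is an expansion
   of [rate ^+ k]. *)
- rewrite big_mkord; under [RHS]eq_bigr do rewrite big_geq_mkord big_distrl/=.
  rewrite (exchange_big_dep xpredT)//=; apply: eq_bigr => k _.
  rewrite -(sum_stirling1_bell rate_gt0 X_poisson).
  (* The range [j < k.+1] becomes a condition on [j < n.+1], matching the exchanged sum. *)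
  rewrite (big_ord_widen _ (fun j => stirling1 k j * bell j (alpha / m%:R))
    (ltn_ord k)).
  by rewrite mulrA big_distrr/=; apply: eq_bigr => j _; rewrite mulrA.
Qed.
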